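(* Every two-dimensional solvable subalgebra of $\mathfrak{sp}(4,\mathbb{C})$ which contains $T_{1,1}$ or $T_{1,-1}$ but is not a Cartan subalgebra is equivalent to one of the inequivalent subalgebras $$\langle T_{1,1},X_{\alpha}\rangle,\qquad \langle T_{1,1},X_{\beta}\rangle,\qquad \langle T_{1,1},X_{\alpha+\beta}\rangle .$$ None of these three subalgebras is equivalent to any of the subalgebras $\mathfrak{t}$, $\langle T_{1,0},X_{\alpha}\rangle$, $\langle T_{1,0},X_{\beta}\rangle$, $\langle T_{1,0},X_{\alpha+2\beta}\rangle$, $\langle T_{3,1},X_{\alpha}+X_{\beta}\rangle$, $\langle T_{a,1},X_{\alpha}\rangle$ ($a\neq0,\pm1$), $\langle T_{a,1},X_{\beta}\rangle$ ($a\neq 0,\pm1$), $\langle T_{a,1},X_{\alpha+\beta}\rangle$ ($a\neq 0,\pm1$), $\langle T_{a,1},X_{\alpha+2\beta}\rangle$ ($a\neq0,\pm1$). Moreover, $\langle T_{1,-1},X_{\alpha+2\beta}\rangle\sim\langle T_{1,1},X_{\alpha}\rangle$, and, for any $c\in\mathbb{C}$, $\langle T_{1,-1},X_{\beta}+cX_{\alpha+2\beta}\rangle\sim\langle T_{1,-1},X_{\beta}\rangle$.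
   Context: Let $J=\begin{pmatrix}0&0&1&0\\0&0&0&1\\-1&0&0&0\\0&-1&0&0\end{pmatrix}$. $\mathfrak{sp}(4,\mathbb{C})$ is the Lie algebra of $4\times4$ complex matrices $X$ with $JX^tJ=X$, and $Sp(4,\mathbb{C})=\{g\in GL(4,\mathbb{C}) : gJg^t=J\}$, acting on $\mathfrak{sp}(4,\mathbb{C})$ by conjugation $X\mapsto gXg^{-1}$. For $a,b\in\mathbb{C}$, $T_{a,b}=\mathrm{diag}(a,b,-a,-b)$, and $\mathfrak{t}=\{T_{a,b}: a,b\in\mathbb{C}\}$. A Cartan subalgebra of $\mathfrak{sp}(4,\mathbb{C})$ is a two-dimensional subalgebra of commuting semisimple (diagonalizable) elements. With $E_{ij}$ the matrix units, $X_\alpha=E_{24}$, $X_\beta=E_{12}-E_{43}$, $X_{\alpha+\beta}=E_{14}+E_{23}$, $X_{\alpha+2\beta}=E_{13}$. $\langle\,\cdot\,\rangle$ denotes the complex linear span. Two subalgebras are equivalent, written $\sim$, if some $g\in Sp(4,\mathbb{C})$ conjugates one onto the other. *)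

(* Defs.v *)
From HB Require Import structures.
From mathcomp Require Import all_boot all_order all_algebra.
From mathcomp Require Import complex.
From mathcomp Require Import reals ring.

Set Implicit Arguments.
Unset Strict Implicit.
Unset Printing Implicit Defensive.

Import GRing.Theory.
Local Open Scope ring_scope.

(* Matrix indices are 0-based: the matrix unit E_{ij} is
   [delta_mx (i-1) (j-1)], the numerals being read in ['I_4]. *)

Definition J {F : fieldType} : 'M[F]_4 :=
  delta_mx 0 2 + delta_mx 1 3 - delta_mx 2 0 - delta_mx 3 1.

Definition torus {F : fieldType} (a b : F) : 'M[F]_4 :=
  diag_mx (\row_(i < 4) [:: a; b; - a; - b]`_i).

Definition X_alpha {F : fieldType} : 'M[F]_4 := delta_mx 1 3.
Definition X_beta {F : fieldType} : 'M[F]_4 := delta_mx 0 1 - delta_mx 3 2.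
Definition X_alpha_beta {F : fieldType} : 'M[F]_4 :=
  delta_mx 0 3 + delta_mx 1 2.
Definition X_alpha_2beta {F : fieldType} : 'M[F]_4 := delta_mx 0 2.

Definition in_sp4 {F : fieldType} (X : 'M[F]_4) : Prop := J *m X^T *m J = X.

Definition in_Sp4 {F : fieldType} (g : 'M[F]_4) : Prop :=
  g \in unitmx /\ g *m J *m g^T = J.

Definition lie {F : fieldType} {n : nat} (X Y : 'M[F]_n) : 'M[F]_n :=
  X *m Y - Y *m X.

Definition sp4_subalgebra {F : fieldType} (U : {vspace 'M[F]_4}) : Prop :=
  (forall X, X \in U -> in_sp4 X) /\
  (forall X Y, X \in U -> Y \in U -> lie X Y \in U).

(* By bilinearity, the brackets of basis elements span all of [U, U];
   see [derived_minP]. *)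
Definition derived {F : fieldType} (U : {vspace 'M[F]_4}) : {vspace 'M[F]_4} :=
  <<[seq lie X Y | X <- vbasis U, Y <- vbasis U]>>%VS.

Definition solvable_lie {F : fieldType} (U : {vspace 'M[F]_4}) : Prop :=
  exists n, iter n derived U = 0%VS.

Definition cartan_subalgebra {F : fieldType} (U : {vspace 'M[F]_4}) : Prop :=
  [/\ sp4_subalgebra U,
      \dim U = 2%N,
      forall X Y, X \in U -> Y \in U -> lie X Y = 0
    & forall X, X \in U -> diagonalizable X].

Definition conj_mx {F : fieldType} (g : 'M[F]_4) (U : {vspace 'M[F]_4}) :
    {vspace 'M[F]_4} :=
  (linfun (mulmxr (invmx g) \o mulmx g) @: U)%VS.

Definition sp4_equiv {F : fieldType} (U V : {vspace 'M[F]_4}) : Prop :=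
  exists2 g, in_Sp4 g & conj_mx g U = V.

Definition span2 {F : fieldType} (X Y : 'M[F]_4) : {vspace 'M[F]_4} :=
  <<[:: X; Y]>>%VS.

(* The diagonal torus algebra, see [mem_cartan_t]. *)
Definition cartan_t {F : fieldType} : {vspace 'M[F]_4} :=
  span2 (torus 1 0) (torus 0 1).

Section Facts.

Context {F : fieldType}.
Implicit Types (U V : {vspace 'M[F]_4}) (X Y g : 'M[F]_4) (a b c : F).

Lemma lieDl X Y Z : lie (X + Y) Z = lie X Z + lie Y Z.
Proof. by rewrite /lie mulmxDl mulmxDr opprD addrACA. Qed.

Lemma lieDr X Y Z : lie X (Y + Z) = lie X Y + lie X Z.
Proof. by rewrite /lie mulmxDl mulmxDr opprD addrACA. Qed.

Lemma lieZl c X Y : lie (c *: X) Y = c *: lie X Y.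
Proof. by rewrite /lie -scalemxAl -scalemxAr scalerBr. Qed.

Lemma lieZr c X Y : lie X (c *: Y) = c *: lie X Y.
Proof. by rewrite /lie -scalemxAl -scalemxAr scalerBr. Qed.

Lemma lie_suml I (r : seq I) (P : pred I) (f : I -> 'M[F]_4) Y :
  lie (\sum_(i <- r | P i) f i) Y = \sum_(i <- r | P i) lie (f i) Y.
Proof. by rewrite /lie mulmx_suml mulmx_sumr sumrB. Qed.

Lemma lie_sumr I (r : seq I) (P : pred I) (f : I -> 'M[F]_4) X :
  lie X (\sum_(i <- r | P i) f i) = \sum_(i <- r | P i) lie X (f i).
Proof. by rewrite /lie mulmx_suml mulmx_sumr sumrB. Qed.

Lemma mem_derived U X Y : X \in U -> Y \in U -> lie X Y \in derived U.
Proof.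
move=> XU YU; rewrite (coord_vbasis XU) (coord_vbasis YU) lie_suml.
apply: memv_suml => i _; rewrite lie_sumr; apply: memv_suml => j _.
rewrite lieZl lieZr !memvZ// memv_span//.
by apply/allpairsP; exists ((vbasis U)`_i, (vbasis U)`_j);
  rewrite !mem_nth// size_tuple.
Qed.

Lemma derived_minP U V :
  (forall X Y, X \in U -> Y \in U -> lie X Y \in V) <-> (derived U <= V)%VS.
Proof.
split=> [h|/subvP h X Y XU YU]; last exact/h/mem_derived.
apply/span_subvP => _ /allpairsP[[X Y] [/= XU YU ->]].
by apply: h; apply: vbasis_mem.
Qed.

Lemma mem_conj_mx g U X :
  X \in conj_mx g U <-> exists2 Y, Y \in U & X = g *m Y *m invmx g.
Proof.
split=> [/memv_imgP[Y YU ->]|[Y YU ->]].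
  by exists Y => //; rewrite lfunE.
by apply/memv_imgP; exists Y => //; rewrite lfunE.
Qed.

Lemma mem_span2 X Y Z :
  Z \in span2 X Y <-> exists a b, Z = a *: X + b *: Y.
Proof.
rewrite /span2 span_cons span_seq1; split.
  by case/memv_addP=> _ /vlineP[a ->] [_ /vlineP[b ->] ->]; exists a, b.
by move=> [a [b ->]]; rewrite memv_add// memvZ// memv_line.
Qed.

Lemma mem_cartan_t X : X \in cartan_t <-> exists a b, X = torus a b.
Proof.
suff E a b : a *: torus 1 0 + b *: torus 0 1 = torus a b.
  by rewrite mem_span2; split=> -[a [b ->]]; exists a, b; rewrite E.
apply/matrixP => i j; rewrite !mxE.
by case: i => -[|[|[|[|[]]]]]//= ?; case: (_ == j);
  rewrite ?(mulr0n, mulr1n, mulr1, mulr0, mulrN, oppr0, addr0, add0r).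
Qed.

Lemma in_sp4P a b X Y : in_sp4 X -> in_sp4 Y -> in_sp4 (a *: X + b *: Y).
Proof.
rewrite /in_sp4; move: J => K hX hY.
have ->: (a *: X + b *: Y)^T = a *: X^T + b *: Y^T.
  by apply/matrixP => i j; rewrite !mxE.
rewrite mulmxDr mulmxDl -!scalemxAr -!scalemxAl.
by rewrite hX hY.
Qed.

Lemma span2_subalgebra X Y c :
  in_sp4 X -> in_sp4 Y -> lie X Y = c *: Y -> sp4_subalgebra (span2 X Y).
Proof.
move=> hX hY hc; split=> [Z /mem_span2[a [b ->]]|]; first exact: in_sp4P.
move=> _ _ /mem_span2[a1 [b1 ->]] /mem_span2[a2 [b2 ->]].
have lZZ Z : lie Z Z = 0 by rewrite /lie subrr.
have lYX : lie Y X = - (c *: Y) by rewrite -hc /lie opprB.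
apply/mem_span2; exists 0, ((a1 * b2 - b1 * a2) * c).
rewrite scale0r add0r !(lieDl, lieDr, lieZl, lieZr) !lZZ lYX hc.
rewrite !scaler0 add0r addr0 !scalerN !scalerA -scaleNr -scalerDl.
by congr (_ *: _); ring.
Qed.

Lemma torus_delta a b :
  torus a b = a *: delta_mx 0 0 + b *: delta_mx 1 1
              - a *: delta_mx 2 2 - b *: delta_mx 3 3.
Proof.
rewrite /torus diag_mx_sum_delta !big_ord_recl big_ord0 !mxE /= addr0 !addrA.
rewrite !scaleNr.
by congr (_ *: delta_mx _ _ + _ *: delta_mx _ _ - _ *: delta_mx _ _
            - _ *: delta_mx _ _); apply: val_inj.
Qed.

Local Ltac mx4_expand :=
  rewrite ?(mulmxDl, mulmxBl, mulmxDr, mulmxBr, mulmxN, mulNmx, mul0mx);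
  rewrite -?(scalemxAl, scalemxAr) ?mul_delta_mx_cond /= ?(mulr1n, mulr0n);
  rewrite ?(scaler0, oppr0, addr0, add0r, opprK).

Local Ltac mx4_sp4 :=
  rewrite /in_sp4 ?(raddfD, raddfN) /= ?trmx_delta /J; do 2! mx4_expand;
  by [|rewrite addrC].

Local Ltac mx4_lie :=
  rewrite /lie !torus_delta; mx4_expand;
  apply/matrixP => ? ?; rewrite !mxE; ring.

Lemma torus_sp4 a b : in_sp4 (torus a b).
Proof.
have -> : torus a b = a *: (delta_mx 0 0 - delta_mx 2 2)
                      + b *: (delta_mx 1 1 - delta_mx 3 3).
  by rewrite torus_delta !scalerBr addrACA addrA.
by apply: in_sp4P; mx4_sp4.
Qed.

Lemma X_alpha_sp4 : in_sp4 (X_alpha : 'M[F]_4).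
Proof. rewrite /X_alpha; mx4_sp4. Qed.

Lemma X_beta_sp4 : in_sp4 (X_beta : 'M[F]_4).
Proof. rewrite /X_beta; mx4_sp4. Qed.

Lemma X_alpha_beta_sp4 : in_sp4 (X_alpha_beta : 'M[F]_4).
Proof. rewrite /X_alpha_beta; mx4_sp4. Qed.

Lemma X_alpha_2beta_sp4 : in_sp4 (X_alpha_2beta : 'M[F]_4).
Proof. rewrite /X_alpha_2beta; mx4_sp4. Qed.

Lemma lie_torus_X_alpha a b :
  lie (torus a b) X_alpha = (2 * b) *: X_alpha.
Proof. rewrite /X_alpha; mx4_lie. Qed.

Lemma lie_torus_X_beta a b :
  lie (torus a b) X_beta = (a - b) *: X_beta.
Proof. rewrite /X_beta; mx4_lie. Qed.

Lemma lie_torus_X_alpha_beta a b :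
  lie (torus a b) X_alpha_beta = (a + b) *: X_alpha_beta.
Proof. rewrite /X_alpha_beta; mx4_lie. Qed.

Lemma lie_torus_X_alpha_2beta a b :
  lie (torus a b) X_alpha_2beta = (2 * a) *: X_alpha_2beta.
Proof. rewrite /X_alpha_2beta; mx4_lie. Qed.

Lemma torus_X_alpha_subalgebra a b :
  sp4_subalgebra (span2 (torus a b) X_alpha).
Proof.
exact: span2_subalgebra (torus_sp4 a b) X_alpha_sp4 (lie_torus_X_alpha a b).
Qed.

Lemma torus_X_beta_subalgebra a b :
  sp4_subalgebra (span2 (torus a b) X_beta).
Proof.
exact: span2_subalgebra (torus_sp4 a b) X_beta_sp4 (lie_torus_X_beta a b).
Qed.

Lemma torus_X_alpha_beta_subalgebra a b :
  sp4_subalgebra (span2 (torus a b) X_alpha_beta).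
Proof.
exact: span2_subalgebra (torus_sp4 a b) X_alpha_beta_sp4 (lie_torus_X_alpha_beta a b).
Qed.

Lemma torus_X_alpha_2beta_subalgebra a b :
  sp4_subalgebra (span2 (torus a b) X_alpha_2beta).
Proof.
exact: span2_subalgebra (torus_sp4 a b) X_alpha_2beta_sp4 (lie_torus_X_alpha_2beta a b).
Qed.

Lemma torus31_subalgebra :
  sp4_subalgebra (span2 (torus 3 1) (X_alpha + X_beta : 'M[F]_4)).
Proof.
apply: (@span2_subalgebra _ _ 2); first exact: torus_sp4.
  rewrite -[X_alpha]scale1r -[X_beta]scale1r.
  by apply: in_sp4P; [exact: X_alpha_sp4|exact: X_beta_sp4].
rewrite lieDr lie_torus_X_alpha lie_torus_X_beta [RHS]scalerDr.
by congr (_ + _); congr (_ *: _); ring.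
Qed.

Lemma torus_1N1_subalgebra c :
  sp4_subalgebra (span2 (torus 1 (-1)) (X_beta + c *: X_alpha_2beta)).
Proof.
apply: (@span2_subalgebra _ _ 2); first exact: torus_sp4.
  rewrite -[X_beta]scale1r.
  by apply: in_sp4P; [exact: X_beta_sp4|exact: X_alpha_2beta_sp4].
rewrite lieDr lieZr lie_torus_X_beta lie_torus_X_alpha_2beta [RHS]scalerDr !scalerA.
by congr (_ + _); congr (_ *: _); ring.
Qed.

Lemma cartan_t_subalgebra : sp4_subalgebra (cartan_t : {vspace 'M[F]_4}).
Proof.
apply: (@span2_subalgebra _ _ 0); try exact: torus_sp4.
mx4_lie.
Qed.

End Facts.

(* Main.v *)
(* In 2x2 blocks an element of sp(4) is [[A, B], [C, -A^T]] with B and C symmetric,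
   and ad T_{1,1} has eigenvalue 0, 2, -2 on A, B, C. So if T_{1,1} lies in a
   two-dimensional subalgebra s, then s = <T_{1,1}, Y> with Y in one of the three
   eigenspaces. In degree 2, GL(2) acts on B by congruence, and B becomes E_22 or
   E_12 + E_21 up to a scalar; J exchanges degrees 2 and -2. In degree 0, A may be
   taken traceless: it is either conjugate to E_12 or diagonalizable, in which case
   s is a Cartan subalgebra. The Weyl reflection in alpha moves T_{1,-1} to T_{1,1}.

   For the inequivalences, T_{1,1} squares to 1, which excludes the algebras
   containing T_{a,b} with a^2 <> b^2, and X squares to 0, which excludes t. The
   three algebras are told apart by commutativity and by the rank of X. *)

Require Import Defs.
From mathcomp Require Import all_boot all_order all_algebra.
From mathcomp Require Import complex.
From mathcomp Require Import reals ring.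

Set Implicit Arguments.
Unset Strict Implicit.
Unset Printing Implicit Defensive.

Import Order.TTheory GRing.Theory Num.Theory.
Local Open Scope ring_scope.

(** * Explicit 2x2 matrices and block calculus on 4x4 matrices *)

Definition mx2 {F : fieldType} (a b c d : F) : 'M[F]_2 :=
  \matrix_(i, j) (nth [::] [:: [:: a; b]; [:: c; d]] i)`_j.

(** The block sizes are explicit because ['M_4] and ['M_(2 + 2)] agree only up to conversion. *)
Definition blk {F : fieldType} (A B C D : 'M[F]_2) : 'M[F]_4 :=
  @block_mx F 2 2 2 2 A B C D.

Section Blocks.
Context {F : fieldType}.
Implicit Types (A B C D : 'M[F]_2) (X : 'M[F]_4) (a b c d : F).

Lemma mx2P A : A = mx2 (A 0 0) (A 0 1) (A 1 0) (A 1 1).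
Proof.
apply/matrixP => -[[|[|[]]] // hi] [[|[|[]]] // hj]; rewrite mxE /=;
  by congr (A _ _); apply: val_inj.
Qed.

Lemma mx2_inj a b c d a' b' c' d' :
  mx2 a b c d = mx2 a' b' c' d' -> [/\ a = a', b = b', c = c' & d = d'].
Proof.
move/matrixP => h; split; [move: (h 0 0)|move: (h 0 1)|move: (h 1 0)|move: (h 1 1)];
  by rewrite !mxE.
Qed.

Lemma mulmx2 a b c d a' b' c' d' :
  mx2 a b c d *m mx2 a' b' c' d' =
  mx2 (a * a' + b * c') (a * b' + b * d') (c * a' + d * c') (c * b' + d * d').
Proof.
by apply/matrixP => -[[|[|[]]] // hi] [[|[|[]]] // hj];
  rewrite !mxE !big_ord_recl big_ord0 !mxE /= addr0.
Qed.

Lemma addmx2 a b c d a' b' c' d' :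
  mx2 a b c d + mx2 a' b' c' d' = mx2 (a + a') (b + b') (c + c') (d + d').
Proof. by apply/matrixP => -[[|[|[]]] // hi] [[|[|[]]] // hj]; rewrite !mxE. Qed.

Lemma oppmx2 a b c d : - mx2 a b c d = mx2 (- a) (- b) (- c) (- d).
Proof. by apply/matrixP => -[[|[|[]]] // hi] [[|[|[]]] // hj]; rewrite !mxE. Qed.

Lemma scalemx2 k a b c d : k *: mx2 a b c d = mx2 (k * a) (k * b) (k * c) (k * d).
Proof. by apply/matrixP => -[[|[|[]]] // hi] [[|[|[]]] // hj]; rewrite !mxE. Qed.

Lemma trmx2 a b c d : (mx2 a b c d)^T = mx2 a c b d.
Proof. by apply/matrixP => -[[|[|[]]] // hi] [[|[|[]]] // hj]; rewrite !mxE. Qed.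

Lemma mx2_0 : 0 = mx2 0 0 0 0 :> 'M[F]_2.
Proof. by apply/matrixP => -[[|[|[]]] // hi] [[|[|[]]] // hj]; rewrite !mxE. Qed.

Lemma mx2_1 : 1%:M = mx2 1 0 0 1 :> 'M[F]_2.
Proof. by apply/matrixP => -[[|[|[]]] // hi] [[|[|[]]] // hj]; rewrite !mxE. Qed.

Lemma blkP X : exists A B C D, X = blk A B C D.
Proof.
exists (@ulsubmx F 2 2 2 2 X), (@ursubmx F 2 2 2 2 X),
  (@dlsubmx F 2 2 2 2 X), (@drsubmx F 2 2 2 2 X).
by rewrite /blk submxK.
Qed.

Lemma blk_inj A B C D A' B' C' D' : blk A B C D = blk A' B' C' D' ->
  [/\ A = A', B = B', C = C' & D = D'].
Proof. by move=> h; apply: (@eq_block_mx F 2 2 2 2). Qed.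

Lemma mulblk A B C D A' B' C' D' : blk A B C D *m blk A' B' C' D' =
  blk (A *m A' + B *m C') (A *m B' + B *m D')
      (C *m A' + D *m C') (C *m B' + D *m D').
Proof. exact: (@mulmx_block _ 2 2 2 2 2 2). Qed.

Lemma addblk A B C D A' B' C' D' : blk A B C D + blk A' B' C' D' =
  blk (A + A') (B + B') (C + C') (D + D').
Proof. exact: (@add_block_mx _ 2 2 2 2). Qed.

Lemma oppblk A B C D : - blk A B C D = blk (- A) (- B) (- C) (- D).
Proof. exact: (@opp_block_mx _ 2 2 2 2). Qed.

Lemma scaleblk k A B C D : k *: blk A B C D = blk (k *: A) (k *: B) (k *: C) (k *: D).
Proof. exact: (@scale_block_mx _ 2 2 2 2). Qed.

Lemma trblk A B C D : (blk A B C D)^T = blk A^T C^T B^T D^T.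
Proof. exact: (@tr_block_mx _ 2 2 2 2). Qed.

Lemma blk_0 : 0 = blk 0 0 0 0 :> 'M[F]_4.
Proof. by symmetry; apply: (@block_mx0 _ 2 2 2 2). Qed.

Lemma blk_1 : 1%:M = blk 1%:M 0 0 1%:M :> 'M[F]_4.
Proof. exact: (@scalar_mx_block F 2 2 1). Qed.

(** Reduces the block form of [J], the torus and the root vectors to a check of sixteen entries. *)
Lemma blk_mx2P X a00 a01 a02 a03 a10 a11 a12 a13
    a20 a21 a22 a23 a30 a31 a32 a33 :
  (forall i j : 'I_4, X i j = (nth [::] [:: [:: a00; a01; a02; a03]; [:: a10; a11; a12; a13];
    [:: a20; a21; a22; a23]; [:: a30; a31; a32; a33]] i)`_j) ->
  X = blk (mx2 a00 a01 a10 a11) (mx2 a02 a03 a12 a13)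
          (mx2 a20 a21 a30 a31) (mx2 a22 a23 a32 a33).
Proof.
move=> h; apply/matrixP => i j; rewrite h.
case: (@split_ordP 2 2 i) => i' ->; case: (@split_ordP 2 2 j) => j' ->;
  rewrite /blk ?(@block_mxEul _ 2 2 2 2, @block_mxEur _ 2 2 2 2,
    @block_mxEdl _ 2 2 2 2, @block_mxEdr _ 2 2 2 2) mxE /=;
  by case: i' => -[|[|[]]] // hi; case: j' => -[|[|[]]].
Qed.

Local Ltac blk_entries := apply: blk_mx2P => -[[|[|[|[|[]]]]] // hi] [[|[|[|[|[]]]]] // hj];
  rewrite !mxE /= ?(mulr1n, mulr0n, subr0, addr0, add0r, sub0r, oppr0).

Lemma J_blk : J = blk 0 1%:M (- 1%:M) 0 :> 'M[F]_4.
Proof. rewrite mx2_0 mx2_1 oppmx2 oppr0; by blk_entries. Qed.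

Lemma torus_blk a b : torus a b = blk (mx2 a 0 0 b) 0 0 (mx2 (- a) 0 0 (- b)).
Proof. rewrite mx2_0; by blk_entries. Qed.

Lemma X_alpha_blk : X_alpha = blk 0 (mx2 0 0 0 1) 0 0 :> 'M[F]_4.
Proof. rewrite mx2_0; by blk_entries. Qed.

Lemma X_beta_blk : X_beta = blk (mx2 0 1 0 0) 0 0 (mx2 0 0 (- 1) 0) :> 'M[F]_4.
Proof. rewrite mx2_0; by blk_entries. Qed.

Lemma X_alpha_beta_blk : X_alpha_beta = blk 0 (mx2 0 1 1 0) 0 0 :> 'M[F]_4.
Proof. rewrite mx2_0; by blk_entries. Qed.

Lemma X_alpha_2beta_blk : X_alpha_2beta = blk 0 (mx2 1 0 0 0) 0 0 :> 'M[F]_4.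
Proof. rewrite mx2_0; by blk_entries. Qed.
End Blocks.

(** * Conjugation by Sp(4) and its invariants *)

Section Conjugation.
Context {F : fieldType}.
Implicit Types (U V : {vspace 'M[F]_4}) (X Y g : 'M[F]_4).

Lemma mulJJ : J *m J = - 1%:M :> 'M[F]_4.
Proof.
rewrite J_blk mulblk !(mul0mx, mulmx0, mulNmx, mulmxN, mulmx1, add0r, addr0).
by rewrite blk_1 oppblk oppr0.
Qed.

(** Since J^2 = -1, the matrix -J g^T J is an explicit right inverse of g, so invertibility follows
    from the symplectic identity. *)
Lemma in_Sp4P g : g *m J *m g^T = J -> in_Sp4 g.
Proof.
move=> hg; split=> //.
have /mulmx1_unit[]// : g *m (- (J *m g^T *m J)) = 1%:M.
by rewrite mulmxN !mulmxA hg mulJJ opprK.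
Qed.

Lemma in_Sp4_trmul g : in_Sp4 g -> g^T *m J = J *m invmx g.
Proof.
move=> [gU hg]; apply: (can_inj (mulmxK gU)); rewrite mulmxKV //.
have /mulmx1C h : g *m (- (J *m g^T *m J)) = 1%:M.
  by rewrite mulmxN !mulmxA hg mulJJ opprK.
have := congr1 (mulmx (- J)) h.
by rewrite mulmx1 !(mulNmx, mulmxN) opprK !mulmxA mulJJ !mulNmx mul1mx => /oppr_inj.
Qed.

Lemma in_Sp4V g : in_Sp4 g -> in_Sp4 (invmx g).
Proof.
move=> [gU hg]; split; first by rewrite unitmx_inv.
by rewrite -{1}hg !mulmxA mulVmx // mul1mx -mulmxA -trmx_mul mulVmx // trmx1 mulmx1.
Qed.

Lemma conj_mxK g U : g \in unitmx -> conj_mx (invmx g) (conj_mx g U) = U.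
Proof.
move=> gU; rewrite /conj_mx -limg_comp -[RHS]lim1g; congr (_ @: _)%VS.
apply/lfunP => X; rewrite comp_lfunE !lfunE /= invmxK !mulmxA mulVmx // mul1mx.
by rewrite mulmxKV.
Qed.

Lemma sp4_equiv_sym U V : sp4_equiv U V -> sp4_equiv V U.
Proof.
by move=> [g hg <-]; exists (invmx g); [exact: in_Sp4V|apply: conj_mxK; case: hg].
Qed.

Lemma sp4_equiv_trans U V W : sp4_equiv U V -> sp4_equiv V W -> sp4_equiv U W.
Proof.
move=> [g [gU hg] <-] [h [hU hh] <-]; exists (h *m g).
  split; first by rewrite unitmx_mul hU.
  by rewrite trmx_mul -!mulmxA (mulmxA J) (mulmxA g) (mulmxA g) hg mulmxA.
rewrite /conj_mx -limg_comp; congr (_ @: _)%VS; apply/lfunP => X.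
rewrite comp_lfunE !lfunE /= -[invmx (h *m g)]/((h * g)^-1) invrM //.
by rewrite -!mulmxE !mulmxA.
Qed.

(** Intertwining relations replace conjugation, so that for a concrete g no inverse has to be
    computed. *)
Lemma span2_equiv g X Y X' Y' : g *m J *m g^T = J ->
  g *m X = X' *m g -> g *m Y = Y' *m g -> sp4_equiv (span2 X Y) (span2 X' Y').
Proof.
move=> /in_Sp4P hg hX hY; exists g => //; case: hg => gU _.
by rewrite /conj_mx /span2 limg_span /= !lfunE /= hX hY !mulmxK.
Qed.

Lemma mulmx_conj g X Y : g \in unitmx ->
  (g *m X *m invmx g) *m (g *m Y *m invmx g) = g *m (X *m Y) *m invmx g.
Proof. by move=> gU; rewrite !mulmxA mulmxKV. Qed.

Lemma lie_conj g X Y : g \in unitmx ->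
  lie (g *m X *m invmx g) (g *m Y *m invmx g) = g *m lie X Y *m invmx g.
Proof. by move=> gU; rewrite /lie !mulmx_conj // mulmxBr mulmxBl. Qed.

Lemma conj_eq0 g X : g \in unitmx -> g *m X *m invmx g = 0 -> X = 0.
Proof.
move=> gU /(congr1 (fun Z => invmx g *m (Z *m g))).
by rewrite mulmxKV // mulKmx // mul0mx mulmx0.
Qed.

(** The relations g^T J = J g^-1 and J g^-T = g J carry the factors g and g^-1 out of J (g X g^-1)^T
    J. *)
Lemma in_sp4_conj g X : in_Sp4 g -> in_sp4 X -> in_sp4 (g *m X *m invmx g).
Proof.
move=> hg hX; have hV := in_Sp4_trmul (in_Sp4V hg).
have hT := in_Sp4_trmul hg; case: hg => gU hg.
have hJ : J *m (invmx g)^T = g *m J.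
  by rewrite -{1}hg trmx_inv mulmxK // unitmx_tr.
by rewrite /in_sp4 !trmx_mul !mulmxA hJ -mulmxA hT -!mulmxA -[in RHS]hX !mulmxA.
Qed.

Lemma mem_conj g U X : X \in U -> g *m X *m invmx g \in conj_mx g U.
Proof. by move=> XU; apply/mem_conj_mx; exists X. Qed.

Lemma subalgebra_equiv U V : sp4_equiv U V -> sp4_subalgebra U -> sp4_subalgebra V.
Proof.
move=> [g hg <-] [Usp Ulie]; split=> [_ /mem_conj_mx[X XU ->]|].
  by apply: in_sp4_conj => //; apply: Usp.
move=> _ _ /mem_conj_mx[X XU ->] /mem_conj_mx[Y YU ->].
by rewrite lie_conj ?mem_conj ?Ulie //; case: hg.
Qed.

Lemma span2_abelian X Y : lie X Y = 0 ->
  forall Z W, Z \in span2 X Y -> W \in span2 X Y -> lie Z W = 0.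
Proof.
move=> h Z W /mem_span2[a [b ->]] /mem_span2[c [d ->]].
have h' : lie Y X = 0 by rewrite /lie -opprB -[X *m Y - _]/(lie X Y) h oppr0.
by rewrite !(lieDl, lieDr, lieZl, lieZr) h h' /lie !subrr !(scaler0, addr0).
Qed.

Lemma dim_equiv U V : sp4_equiv U V -> \dim V = \dim U.
Proof.
have le W W' : sp4_equiv W W' -> (\dim W' <= \dim W)%N.
  move=> [g _ <-]; pose f := linfun (mulmxr (invmx g) \o mulmx g).
  by rewrite -[\dim W](limg_ker_dim f) leq_addl.
by move=> h; apply/eqP; rewrite eqn_leq !le //; apply: sp4_equiv_sym.
Qed.

Lemma abelian_equiv U V : sp4_equiv U V ->
  (forall X Y, X \in V -> Y \in V -> lie X Y = 0) ->
  forall X Y, X \in U -> Y \in U -> lie X Y = 0.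
Proof.
move=> [g [gU _] <-] Vab X Y XU YU; apply: (conj_eq0 gU).
by rewrite -lie_conj //; apply: Vab; apply: mem_conj.
Qed.

(** For diagonalizability: if P diagonalizes g X g^-1, then P g diagonalizes X. *)
Lemma cartan_equiv U V : sp4_equiv U V -> cartan_subalgebra V -> cartan_subalgebra U.
Proof.
move=> h [Vsub Vdim Vab Vdiag]; split.
- exact: subalgebra_equiv (sp4_equiv_sym h) Vsub.
- by rewrite -(dim_equiv h).
- exact: abelian_equiv h Vab.
move=> X; case: h => g [gU _] eqV XU.
have : g *m X *m invmx g \in V by rewrite -eqV mem_conj.
move=> /Vdiag[P PU]; rewrite /similar_to conjumx // => hP.
exists (P *m g); first by rewrite unitmx_mul PU.
rewrite /similar_to conjumx ?unitmx_mul ?PU //.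
by rewrite -[invmx (P *m g)]/((P * g)^-1) invrM // -!mulmxE !mulmxA in hP *.
Qed.

End Conjugation.

(** * Invariants separating the subalgebras *)

Section Inequivalence.
Context {F : numFieldType}.
Implicit Types (X Y g : 'M[F]_4) (a b c d : F).

Lemma mulmx_torus1 : torus 1 1 *m torus 1 1 = 1%:M :> 'M[F]_4.
Proof.
rewrite torus_blk mulblk !mulmx2 !(mul0mx, mulmx0, addr0, add0r, mulr1, mulr0, mul0r, mulrNN).
by rewrite blk_1 mx2_1.
Qed.

(* Conjugation preserves [T_{1,1}^2 = 1], whereas the diagonal of the square of
   [c T_{a,b} + d X] is [(c^2 a^2, c^2 b^2, ...)]. *)
Lemma torus1_not_equiv X a b x (B D : 'M[F]_2) : a ^+ 2 != b ^+ 2 ->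
  ~ sp4_equiv (span2 (torus 1 1) X) (span2 (torus a b) (blk (mx2 0 x 0 0) B 0 D)).
Proof.
move=> hab [g [gU _] eqV].
have : g *m torus 1 1 *m invmx g \in span2 (torus a b) (blk (mx2 0 x 0 0) B 0 D).
  by rewrite -eqV; apply/mem_conj/mem_span2; exists 1, 0; rewrite scale1r scale0r addr0.
move=> /mem_span2[c [d hZ]]; have := mulmx_conj (torus 1 1) (torus 1 1) gU.
rewrite mulmx_torus1 mulmx1 mulmxV // hZ torus_blk !scaleblk addblk mulblk blk_1.
move=> /blk_inj[+ _ _ _]; rewrite !scaler0 addr0 mulmx0 addr0.
rewrite !scalemx2 !addmx2 mulmx2 mx2_1 => /mx2_inj[h1 _ _ h2].
have ca : c ^+ 2 * a ^+ 2 = 1 by rewrite -h1; ring.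
have cb : c ^+ 2 * b ^+ 2 = 1 by rewrite -h2; ring.
have hc : c ^+ 2 != 0.
  by apply/eqP => c0; move/eqP: ca; rewrite c0 mul0r eq_sym oner_eq0.
by case/eqP: hab; apply: (mulfI hc); rewrite ca cb.
Qed.

Lemma torus_nilpotent a b : torus a b *m torus a b = 0 -> torus a b = 0 :> 'M[F]_4.
Proof.
rewrite !torus_blk blk_0 mulblk => /blk_inj[+ _ _ _].
rewrite mulmx0 addr0 mulmx2 mx2_0 => /mx2_inj[ha _ _ hb].
have /eqP : a * a = 0 by ring: ha.
have /eqP : b * b = 0 by ring: hb.
by rewrite !mulf_eq0 !orbb => /eqP -> /eqP ->; rewrite !oppr0.
Qed.

(** A conjugate of X inside t would be a diagonal matrix of square zero, hence zero. *)
Lemma nilpotent_not_equiv_cartan_t Z X : X *m X = 0 -> X != 0 ->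
  ~ sp4_equiv (span2 Z X) cartan_t.
Proof.
move=> hX /eqP X0 [g [gU _] eqV]; apply: X0; apply: (conj_eq0 gU).
have : g *m X *m invmx g \in cartan_t.
  by rewrite -eqV; apply/mem_conj/mem_span2; exists 0, 1; rewrite scale1r scale0r add0r.
move=> /mem_cartan_t[a [b hY]]; rewrite hY; apply: torus_nilpotent.
by rewrite -hY mulmx_conj // hX mulmx0 mul0mx.
Qed.

(** The root beta vanishes on T_{1,1}, so the right-hand algebra is abelian, while the left-hand one
    is not. *)
Lemma nonabelian_not_equiv_X_beta (k : F) X : k != 0 -> X != 0 ->
  lie (torus 1 1) X = k *: X ->
  ~ sp4_equiv (span2 (torus 1 1) X) (span2 (torus 1 1) X_beta).
Proof.
move=> k0 X0 hX /abelian_equiv hab.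
have/eqP : lie (torus 1 1) X = 0.
  apply: hab => [||].
  - by apply: span2_abelian; rewrite lie_torus_X_beta subrr scale0r.
  - by apply/mem_span2; exists 1, 0; rewrite scale1r scale0r addr0.
  - by apply/mem_span2; exists 0, 1; rewrite scale1r scale0r add0r.
by rewrite hX scaler_eq0 (negPf k0) (negPf X0).
Qed.

(* [X_alpha] has rank one, so [X_alpha M X_alpha] is a multiple of [X_alpha] for
   every [M]; no nonzero multiple of [X_alpha_beta] has this property. *)
Lemma X_alpha_not_equiv_X_alpha_beta :
  ~ sp4_equiv (span2 (torus (1 : F) 1) X_alpha) (span2 (torus 1 1) X_alpha_beta).
Proof.
move=> [g [gU _] eqV].
have : g *m X_alpha *m invmx g \in span2 (torus 1 1) X_alpha_beta.
  by rewrite -eqV; apply/mem_conj/mem_span2; exists 0, 1; rewrite scale1r scale0r add0r.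
move=> /mem_span2[c [d hZ]]; set Y := g *m X_alpha *m invmx g in hZ.
have YMY M : exists k, Y *m M *m Y = k *: Y.
  have [k hk] : exists k, X_alpha *m (invmx g *m M *m g) *m X_alpha = k *: (X_alpha : 'M[F]_4).
    (* E_24 N E_24 = N_42 E_24, and the entry N_42 is the last entry of the lower left block. *)
    have [A [B [C [D ->]]]] := blkP (invmx g *m M *m g); exists (C 1 1).
    rewrite X_alpha_blk !mulblk scaleblk !scaler0 scalemx2 (mx2P C).
    rewrite !(mul0mx, mulmx0, addr0, add0r) !mulmx2 mxE /=.
    by rewrite !(mul0r, mulr0, mul1r, mulr1, addr0, add0r).
  by exists k; rewrite /Y scalemxAl scalemxAr -hk !mulmxA.
have Y0 : Y != 0.
  apply/eqP => /(conj_eq0 gU); rewrite X_alpha_blk blk_0 => /blk_inj[_ + _ _].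
  by rewrite mx2_0 => /mx2_inj[_ _ _ /eqP]; rewrite oner_eq0.
(* Y^2 = 0 forces c = 0, the diagonal part of Y^2 being c^2; only Y = d X_{alpha+beta} remains. *)
have YY : Y *m Y = 0.
  rewrite mulmx_conj // X_alpha_blk mulblk !(mul0mx, mulmx0) !addr0 -blk_0.
  by rewrite mulmx0 mul0mx.
move: YY YMY Y0; rewrite hZ torus_blk X_alpha_beta_blk !scaleblk !addblk.
rewrite !scaler0 !addr0 !add0r !scalemx2 !(mulr0, mulr1).
rewrite mulblk blk_0 => /blk_inj[+ _ _ _]; rewrite mulmx0 addr0 mulmx2 mx2_0.
move=> /mx2_inj[h0 _ _ _]; have /eqP : c * c = 0 by ring: h0.
rewrite mulf_eq0 orbb => /eqP->.
rewrite mul0r -mx2_0.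
(* With M = E_41, the upper right block of Y M Y is d^2 E_12, whereas that of k Y has both
   off-diagonal entries equal to k d; hence d^2 = k d = 0. *)
move=> /(_ (blk 0 0 (mx2 0 0 1 0) 0))[k]; rewrite !mulblk scaleblk.
move=> /blk_inj[_ + _ _]; rewrite !(mul0mx, mulmx0, addr0, add0r) !mulmx2 scalemx2.
rewrite !(mul0r, mulr0, mulr1, addr0, add0r).
move=> /mx2_inj[_ h1 h2 _] /eqP[]; have /eqP : d * d = 0 by rewrite h1 -h2.
by rewrite mulf_eq0 orbb => /eqP->; rewrite -mx2_0.
Qed.

End Inequivalence.

(** * Bases of two-dimensional subalgebras and the action of the Levi subgroup GL(2) *)

Section Spans.
Context {F : fieldType}.
Implicit Types (X Y : 'M[F]_4) (c d : F).

Lemma span2Z c d X Y : c != 0 -> d != 0 -> span2 (c *: X) (d *: Y) = span2 X Y.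
Proof.
move=> c0 d0; apply/vspaceP => Z.
apply/idP/idP => /mem_span2[a [b ->]]; apply/mem_span2.
  by exists (a * c), (b * d); rewrite !scalerA.
by exists (a / c), (b / d); rewrite !scalerA !mulfVK.
Qed.

Lemma span2_addZ k X Y : span2 X (Y + k *: X) = span2 X Y.
Proof.
apply/vspaceP => Z; apply/idP/idP => /mem_span2[a [b ->]]; apply/mem_span2.
  by exists (a + b * k), b; rewrite scalerDr scalerA scalerDl -addrA [_ *: X + b *: Y]addrC.
exists (a - b * k), b.
by rewrite scalerDr scalerA scalerBl [b *: Y + _]addrC addrA subrK.
Qed.

Lemma span2_of_dim2 (s : {vspace 'M[F]_4}) X : \dim s = 2%N -> X \in s -> X != 0 ->
  exists Y, Y \notin <[X]>%VS /\ s = span2 X Y.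
Proof.
move=> ds Xs X0.
have /subvPn[Y Ys YX] : ~~ (s <= <[X]>)%VS.
  by apply/negP => /dimvS; rewrite ds dim_vline X0.
exists Y; split=> //; apply/eqP; rewrite eq_sym eqEdim ds; apply/andP; split.
  by apply/span_subvP => Z; rewrite !inE => /orP[]/eqP->.
have : free [:: Y; X] by rewrite free_cons span_seq1 YX seq1_free.
rewrite /free => /eqP /= h; suff -> : \dim (span2 X Y) = 2%N by [].
by apply: etrans h; congr (\dim _); apply: eq_span => Z; rewrite !inE orbC.
Qed.

Lemma in_sp4_blkP (A B C D : 'M[F]_2) : in_sp4 (blk A B C D) ->
  [/\ B^T = B, C^T = C & D = - A^T].
Proof.
rewrite /in_sp4 J_blk trblk !mulblk.
rewrite !(mul0mx, mulmx0, add0r, addr0, mulmxN, mulNmx, mulmx1, mul1mx, opprK).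
by move=> /blk_inj[].
Qed.

Lemma unitmx2 a b c d : a * d - b * c != 0 -> mx2 a b c d \in @unitmx F 2.
Proof.
move=> h; have /mulmx1_unit[]// : mx2 a b c d *m
  ((a * d - b * c)^-1 *: mx2 d (- b) (- c) a) = 1%:M.
by rewrite scalemx2 mulmx2 mx2_1; congr mx2; field.
Qed.

Lemma torus1_blk : torus 1 1 = blk 1%:M 0 0 (- 1%:M) :> 'M[F]_4.
Proof. by rewrite torus_blk mx2_1 oppmx2 oppr0. Qed.

(* [block_diag (A, A^-T)] lies in Sp(4) and commutes with [T_{1,1}]. *)
Lemma levi_Sp4 (A A' : 'M[F]_2) : A *m A'^T = 1%:M ->
  blk A 0 0 A' *m J *m (blk A 0 0 A')^T = J.
Proof.
move=> h; have h' : A' *m A^T = 1%:M by rewrite -[LHS]trmxK trmx_mul trmxK h trmx1.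
rewrite J_blk trblk !mulblk trmx0.
by rewrite !(mul0mx, mulmx0, add0r, addr0, mulmxN, mulNmx, mulmx1) h h'.
Qed.

Lemma levi_torus1 (A A' : 'M[F]_2) :
  blk A 0 0 A' *m torus 1 1 = torus 1 1 *m blk A 0 0 A'.
Proof.
by rewrite torus1_blk !mulblk !(mul0mx, mulmx0, add0r, addr0, mulmxN, mulNmx, mulmx1, mul1mx).
Qed.

Lemma levi_equiv_sym (A B : 'M[F]_2) : A \in unitmx ->
  sp4_equiv (span2 (torus 1 1) (blk 0 B 0 0))
            (span2 (torus 1 1) (blk 0 (A *m B *m A^T) 0 0)).
Proof.
move=> AU; apply: (@span2_equiv _ (blk A 0 0 (invmx A)^T)).
- by apply: levi_Sp4; rewrite trmxK mulmxV.
- exact: levi_torus1.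
rewrite !mulblk !(mul0mx, mulmx0, add0r, addr0) -mulmxA -trmx_mul mulVmx //.
by rewrite trmx1 mulmx1.
Qed.

(** The lower right block A^-T carries -E^T to -E'^T, which is the transpose of the relation on the
    upper left block. *)
Lemma levi_equiv_gl (A E E' : 'M[F]_2) : A \in unitmx -> A *m E = E' *m A ->
  sp4_equiv (span2 (torus 1 1) (blk E 0 0 (- E^T)))
            (span2 (torus 1 1) (blk E' 0 0 (- E'^T))).
Proof.
move=> AU hE; apply: (@span2_equiv _ (blk A 0 0 (invmx A)^T)).
- by apply: levi_Sp4; rewrite trmxK mulmxV.
- exact: levi_torus1.
rewrite !mulblk !(mul0mx, mulmx0, add0r, addr0) hE mulmxN mulNmx -!trmx_mul.
congr (blk _ _ _ (- _^T)).
by rewrite -[LHS](mulKmx AU) [A *m (E *m _)]mulmxA hE mulmxK.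
Qed.

(** Conjugation by J sends T_{1,1} to -T_{1,1} and moves the block C to the upper right with a minus
    sign; both signs are absorbed by rescaling the basis. *)
Lemma J_equiv (C : 'M[F]_2) :
  sp4_equiv (span2 (torus 1 1) (blk 0 0 C 0)) (span2 (torus 1 1) (blk 0 C 0 0)).
Proof.
have n1 : -1 != 0 :> F by rewrite oppr_eq0 oner_eq0.
rewrite -[X in sp4_equiv _ X](span2Z _ _ n1 n1); apply: (@span2_equiv _ J).
- rewrite J_blk trblk !mulblk !linearN /= trmx1 trmx0.
  by rewrite !(mul0mx, mulmx0, add0r, addr0, mulmxN, mulNmx, mulmx1, mul1mx, opprK).
- rewrite torus1_blk J_blk scaleblk !mulblk !scaleN1r.
  by rewrite !(mul0mx, mulmx0, add0r, addr0, mulmxN, mulNmx, mulmx1, mul1mx, opprK, oppr0).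
rewrite J_blk scaleblk !mulblk !scaleN1r.
by rewrite !(mul0mx, mulmx0, add0r, addr0, mulmxN, mulNmx, mulmx1, mul1mx, opprK, oppr0).
Qed.

End Spans.

(** * Normal forms of symmetric and traceless 2x2 matrices *)

Section Classification.
Context {F : numClosedFieldType}.
Implicit Types (A B : 'M[F]_2).

(* The rows of [A] are an isotropic vector followed by any completion to a basis. *)
Lemma sym2_isotropic B : exists2 A, A \in unitmx & (A *m B *m A^T) 0 0 = 0.
Proof.
rewrite (mx2P B); move: (B 0 0) (B 0 1) (B 1 0) (B 1 1) => a b b' c.
have [a0|a0] := eqVneq a 0.
  by exists 1%:M; [exact: unitmx1|rewrite mul1mx trmx1 mulmx1 mxE].
(* The value of B on the vector (x, 1) is a x^2 + (b + b') x + c; r is a square root of its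
   discriminant. *)
pose r := sqrtC ((b + b') ^+ 2 - 4 * a * c).
pose x := (r - (b + b')) / (2 * a).
exists (mx2 x 1 1 0); first by apply: unitmx2; rewrite mulr0 mulr1 sub0r oppr_eq0 oner_eq0.
rewrite trmx2 !mulmx2 mxE /=.
have hr : r ^+ 2 = (b + b') ^+ 2 - 4 * a * c by rewrite sqrtCK.
(* Completing the square: 4a times the quadratic is (2 a x + b + b')^2 minus the discriminant, and 2
   a x + b + b' = r. *)
apply: (mulfI (_ : 4 * a != 0)); first by rewrite mulf_neq0 // pnatr_eq0.
rewrite mulr0 [LHS](_ : _ = r ^+ 2 - ((b + b') ^+ 2 - 4 * a * c)).
  by rewrite hr subrr.
by rewrite /x; field.
Qed.

(** An isotropic first basis vector makes the first diagonal entry zero. The two forms correspond to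
    rank one (off-diagonal entry zero) and rank two. *)
Lemma sym2_normal_form B : B^T = B -> B != 0 ->
  exists2 A, A \in unitmx &
    exists2 k, k != 0 & A *m B *m A^T = k *: mx2 0 0 0 1 \/
                        A *m B *m A^T = k *: mx2 0 1 1 0.
Proof.
move=> symB B0; have [P PU] := sym2_isotropic B.
set B' := P *m B *m P^T => B'00.
have symB' : B'^T = B' by rewrite /B' !trmx_mul trmxK symB mulmxA.
have B'0 : B' != 0.
  apply: contra_neq B0 => h; rewrite -[B](mulKmx PU) -[P *m B](mulmxK (_ : P^T \in unitmx)).
    by rewrite -/B' h mul0mx mulmx0.
  by rewrite unitmx_tr.
have eB' : B' = mx2 0 (B' 0 1) (B' 0 1) (B' 1 1).
  by rewrite {1}(mx2P B') B'00 -{2}symB' [(_^T) 1 0]mxE.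
move: (B' 0 1) (B' 1 1) eB' => b c eB'.
have [b0|b0] := eqVneq b 0.
  exists P => //; exists c; last first.
    by left; rewrite -/B' eB' b0 scalemx2 !mulr0 mulr1.
  by apply: contra_neq B'0 => c0; rewrite eB' b0 c0 -mx2_0.
(* A shear with parameter t changes the last diagonal entry c into c + 2 t b. *)
pose Q := mx2 1 0 (- c / (2 * b)) 1.
exists (Q *m P).
  rewrite unitmx_mul PU andbT; apply: unitmx2.
  by rewrite mulr1 mul0r subr0 oner_eq0.
exists b => //; right.
have -> : Q *m P *m B *m (Q *m P)^T = Q *m B' *m Q^T by rewrite trmx_mul !mulmxA.
rewrite eB' /Q trmx2 !mulmx2 scalemx2.
by congr mx2; field.
Qed.

Lemma symmetric_classification B : B^T = B -> B != 0 ->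
  sp4_equiv (span2 (torus 1 1) (blk 0 B 0 0)) (span2 (torus 1 1) X_alpha) \/
  sp4_equiv (span2 (torus 1 1) (blk 0 B 0 0)) (span2 (torus 1 1) X_alpha_beta).
Proof.
move=> symB B0; have [A AU [k k0 hA]] := sym2_normal_form symB B0.
have := levi_equiv_sym B AU.
have blkZ M : blk 0 (k *: M) 0 0 = k *: blk 0 M 0 0 by rewrite scaleblk !scaler0.
case: hA => ->;
  rewrite blkZ -[torus 1 1 in X in sp4_equiv _ X]scale1r span2Z ?oner_eq0 // => h.
  by left; rewrite X_alpha_blk.
by right; rewrite X_alpha_beta_blk.
Qed.

(* Cyclic vector: [P] has rows [v] and [v A], and [A^2 = (a^2 + b c) 1]. *)
Lemma traceless_companion (a b c : F) : mx2 a b c (- a) != 0 ->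
  exists2 P, P \in unitmx & P *m mx2 a b c (- a) = mx2 0 1 (a ^+ 2 + b * c) 0 *m P.
Proof.
(* The cyclic vector is e_1 if b is nonzero, e_2 if c is nonzero, and (1, 1) if the matrix is
   diag(a, -a). *)
move=> A0; have [b0|b0] := eqVneq b 0; last first.
  exists (mx2 1 0 a b); first by apply: unitmx2; rewrite mul1r mul0r subr0.
  by rewrite !mulmx2; congr mx2; ring.
have [c0|c0] := eqVneq c 0; last first.
  exists (mx2 0 1 c (- a)); first by apply: unitmx2; rewrite mul1r mul0r sub0r oppr_eq0.
  by rewrite !mulmx2; congr mx2; ring.
exists (mx2 1 1 a (- a)); last by rewrite b0 c0 !mulmx2; congr mx2; ring.
apply: unitmx2; rewrite !mul1r -opprD oppr_eq0 -mulr2n mulrn_eq0 /=.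
by apply: contra_neq A0 => a0; rewrite a0 b0 c0 oppr0 -mx2_0.
Qed.

Lemma gl_classification A : ~~ is_scalar_mx A ->
  let s := span2 (torus 1 1) (blk A 0 0 (- A^T)) in
  sp4_equiv s (span2 (torus 1 1) X_beta) \/
  exists2 m : F, m != 0 & sp4_equiv s (span2 (torus 1 1) (torus m (- m))).
Proof.
(* Splitting off the scalar part k, half the trace, amounts to subtracting k T_{1,1} from the second
   generator. *)
move=> nA; pose k := (A 0 0 + A 1 1) / 2; pose a := (A 0 0 - A 1 1) / 2.
have eA : A = mx2 a (A 0 1) (A 1 0) (- a) + k%:M.
  rewrite -scalemx1 mx2_1 scalemx2 addmx2 {1}(mx2P A).
  by congr mx2; rewrite /a /k; field.
move: (A 0 1) (A 1 0) eA => b c eA.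
have T0 : mx2 a b c (- a) != 0.
  apply: contraNneq nA => h; rewrite eA h add0r; exact: scalar_mx_is_scalar.
have -> : blk A 0 0 (- A^T) =
    blk (mx2 a b c (- a)) 0 0 (- (mx2 a b c (- a))^T) + k *: torus 1 1.
  rewrite torus1_blk scaleblk addblk eA linearD /= tr_scalar_mx opprD !scaler0 !addr0.
  by rewrite scalerN scalemx1.
rewrite span2_addZ.
have [P PU hP] := traceless_companion T0; set e := a ^+ 2 + b * c in hP.
have h1 := levi_equiv_gl PU hP.
(* Here e is minus the determinant of the traceless part: for e = 0 the companion matrix is E_12,
   giving X_beta; otherwise it has distinct eigenvalues m and -m with m^2 = e. *)
have [e0|e0] := eqVneq e 0.
  by left; move: h1; rewrite e0 X_beta_blk !trmx2 !oppmx2 oppr0.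
right; pose m := sqrtC e; have m0 : m != 0 by rewrite sqrtC_eq0.
exists m => //; apply: (sp4_equiv_trans h1).
have -> : torus m (- m) = blk (mx2 m 0 0 (- m)) 0 0 (- (mx2 m 0 0 (- m))^T).
  by rewrite torus_blk trmx2 oppmx2 oppr0.
have hm : m ^+ 2 = e by rewrite sqrtCK.
(* The rows (m, 1) and (-m, 1) are left eigenvectors of the companion matrix. *)
apply: (@levi_equiv_gl _ (mx2 m 1 (- m) 1)).
  by apply: unitmx2; rewrite mulr1 mul1r opprK -mulr2n mulrn_eq0.
by rewrite !mulmx2 -hm; congr mx2; ring.
Qed.

End Classification.

(** * Two-dimensional subalgebras containing T_{1,1} *)

Section SolvableSubalgebras.
Context {F : numClosedFieldType}.
Implicit Types (s : {vspace 'M[F]_4}) (a b c m : F).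

Lemma torus_cartan s m : m != 0 -> \dim s = 2%N ->
  sp4_equiv s (span2 (torus 1 1) (torus m (- m))) -> cartan_subalgebra s.
Proof.
move=> m0 ds h; have lie0 : lie (torus 1 1) (torus m (- m)) = 0 :> 'M[F]_4.
  rewrite /lie !torus_blk !mulblk !(mul0mx, mulmx0, addr0, add0r) !mulmx2.
  by rewrite !(mul0r, mulr0, mul1r, mulr1, mulN1r, mulrN1, addr0, add0r) subrr.
apply: (cartan_equiv h); split.
- by apply: (@span2_subalgebra _ _ _ 0); rewrite ?lie0 ?scale0r //; apply: torus_sp4.
- by rewrite (dim_equiv h).
- exact: span2_abelian.
move=> X /mem_span2[a [b ->]]; exists 1%:M; first exact: unitmx1.
rewrite /similar_to conjumx ?unitmx1 // mul1mx invmx1 mulmx1.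
by apply/is_diag_mxP => i j ij; rewrite !mxE -val_eqE (negPf ij) !mulr0n !mulr0 addr0.
Qed.

(* [ad T_{1,1}] grades sp(4) in degrees 2, 0, -2: the upper right, diagonal and
   lower left blocks. The complement of [T_{1,1}] in [s] is homogeneous up to a
   multiple of [T_{1,1}]. *)
Lemma subalgebra_torus1 s : sp4_subalgebra s -> \dim s = 2%N -> torus 1 1 \in s ->
  ~ cartan_subalgebra s ->
  [\/ sp4_equiv s (span2 (torus 1 1) X_alpha),
      sp4_equiv s (span2 (torus 1 1) X_beta)
    | sp4_equiv s (span2 (torus 1 1) X_alpha_beta)].
Proof.
move=> [ssp slie] ds Ts ncs.
have T0 : torus 1 1 != 0 :> 'M[F]_4.
  apply/eqP; rewrite torus_blk blk_0 mx2_0 => /blk_inj[/mx2_inj[/eqP + _ _ _] _ _ _].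
  by rewrite oner_eq0.
have [Y [YT es]] := span2_of_dim2 ds Ts T0.
have Ys : Y \in s by rewrite es; apply/mem_span2; exists 0, 1; rewrite scale1r scale0r add0r.
have := ssp Y Ys; have := slie _ _ Ts Ys; rewrite {1}es => /mem_span2[p [q]].
have [A [B [C [D eY]]]] := blkP Y; rewrite eY => + /in_sp4_blkP[symB symC eD].
rewrite /lie {1 2 3}torus1_blk !mulblk oppblk !scaleblk !addblk.
rewrite !(mul0mx, mulmx0, add0r, addr0, mulmxN, mulNmx, mulmx1, mul1mx, opprK, scaler0).
(* Comparing blocks in [T_{1,1}, Y] = p T_{1,1} + q Y gives 0 = p + q A, 2B = q B and -2C = q C. *)
rewrite subrr => /blk_inj[hA hB hC _].
have four : (4 : F) != 0 by rewrite pnatr_eq0.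
have [q0|q0] := eqVneq q 0.
  have two M : M + M = 0 -> M = 0 :> 'M[F]_2.
    move=> /eqP; rewrite -mulr2n -scaler_nat scaler_eq0 pnatr_eq0 /= => /eqP; exact.
  have {}hB : B = 0 by apply: two; rewrite hB q0 scale0r.
  have {}hC : C = 0 by apply: two; apply: oppr_inj; rewrite opprD hC q0 scale0r oppr0.
  (* With B = C = 0, a scalar A would make Y a multiple of T_{1,1}. *)
  have nA : ~~ is_scalar_mx A.
    apply: contra YT => /is_scalar_mxP[k ek]; apply/vlineP; exists k.
    by rewrite eY ek eD ek hB hC torus1_blk scaleblk !scaler0 tr_scalar_mx scalerN scalemx1.
  rewrite es eY hB hC eD.
  case: (gl_classification nA) => [h|[m m0 h]]; first by constructor 2.
  by case: ncs; apply: (torus_cartan m0 ds); rewrite es eY hB hC eD.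
(* For q nonzero A is scalar, so adding (p/q) T_{1,1} to Y leaves only the off-diagonal blocks. *)
have eA : A = - (p / q) *: 1%:M.
  apply: (scalerI q0); apply: (addrI (p *: 1%:M)).
  by rewrite -hA scalerA mulrN mulrCA divff // mulr1 scaleNr subrr.
have eT : Y + (p / q) *: torus 1 1 = blk 0 B C 0.
  rewrite eY eD eA torus1_blk scaleblk addblk !scaler0 !addr0.
  by rewrite linearZ /= trmx1 scalerN !scaleNr opprK addNr subrr.
have {}es : s = span2 (torus 1 1) (blk 0 B C 0) by rewrite -eT span2_addZ.
rewrite es.
have [B0|B0] := eqVneq B 0.
  have C0 : C != 0.
    apply: contraNneq YT => C0; apply/vlineP; exists (- (p / q)).
    by rewrite scaleNr; apply/eqP; rewrite -addr_eq0 eT B0 C0 -blk_0.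
  rewrite B0; have hJ := J_equiv C.
  by case: (symmetric_classification symC C0) => h; [constructor 1|constructor 3];
    apply: sp4_equiv_trans hJ h.
(* A nonzero B forces q = 2, and then -2C = q C becomes 4C = 0. *)
have q2 : q = 2.
  apply/eqP; rewrite -subr_eq0; have /eqP : (q - 2) *: B = 0.
    by rewrite scalerBl -hB scaler_nat mulr2n subrr.
  by rewrite scaler_eq0 (negPf B0) orbF.
have C0 : C = 0.
  apply/eqP; have /eqP : 4 *: C = 0.
    rewrite (_ : 4 = 2 + q); last by rewrite q2 -natrD.
    by rewrite scalerDl -hC scaler_nat mulr2n -opprD subrr.
  by rewrite scaler_eq0 (negPf four).
rewrite C0.
by case: (symmetric_classification symB B0) => h; [constructor 1|constructor 3].
Qed.

End SolvableSubalgebras.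

(** * The reflection in alpha and the equivalences involving T_{1,-1} *)

Section Weyl.
Context {F : fieldType}.

(** Exchanges e_2 and e_4 up to sign and fixes e_1 and e_3, hence negates b in T_{a,b}. *)
Definition weyl_alpha : 'M[F]_4 :=
  blk (mx2 1 0 0 0) (mx2 0 0 0 1) (mx2 0 0 0 (- 1)) (mx2 1 0 0 0).

Local Ltac blk_compute := rewrite ?mx2_0 ?mx2_1 ?oppmx2 ?mulblk ?(mulmx2, addmx2);
  by congr blk; congr mx2; ring.

Lemma weyl_alpha_Sp4 : weyl_alpha *m J *m weyl_alpha^T = J.
Proof. rewrite /weyl_alpha J_blk trblk !trmx2; blk_compute. Qed.

Lemma weyl_alpha_torus a b : weyl_alpha *m torus a b = torus a (- b) *m weyl_alpha.
Proof. rewrite /weyl_alpha !torus_blk; blk_compute. Qed.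

(** The reflection commutes with X_{alpha+2beta}; the permutation matrix in GL(2) then carries the
    upper right block E_11 to E_22, that is, to X_alpha. *)
Lemma torus1N1_X_alpha_2beta_equiv :
  sp4_equiv (span2 (torus (1 : F) (- 1)) X_alpha_2beta) (span2 (torus 1 1) X_alpha).
Proof.
apply: (@sp4_equiv_trans _ _ (span2 (torus 1 1) X_alpha_2beta)).
  apply: (span2_equiv weyl_alpha_Sp4); first by rewrite weyl_alpha_torus opprK.
  rewrite /weyl_alpha X_alpha_2beta_blk; blk_compute.
have AU : mx2 0 1 1 0 \in @unitmx F 2.
  by apply: unitmx2; rewrite mulr0 mulr1 sub0r oppr_eq0 oner_eq0.
have := levi_equiv_sym (mx2 1 0 0 0) AU.
rewrite trmx2 !mulmx2 X_alpha_blk X_alpha_2beta_blk.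
by rewrite !(mul0r, mulr0, mul1r, mulr1, addr0, add0r).
Qed.

(* Conjugation by [exp (c/2 X_alpha_beta)]. *)
Lemma torus1N1_X_beta_equiv (c : F) : (2 : F) != 0 ->
  sp4_equiv (span2 (torus 1 (- 1)) (X_beta + c *: X_alpha_2beta))
            (span2 (torus 1 (- 1)) X_beta).
Proof.
move=> n2; pose t := c / 2; have ct : c = t + t by rewrite /t; field.
(* This is 1 + t X_{alpha+beta}, as X_{alpha+beta} has square zero. It fixes T_{1,-1}, on which
   alpha+beta vanishes, and [X_{alpha+beta}, X_beta] = -2 X_{alpha+2beta} explains t = c/2. *)
apply: (@span2_equiv _ (blk (mx2 1 0 0 1) (mx2 0 t t 0) 0 (mx2 1 0 0 1))).
- rewrite J_blk trblk trmx0 !trmx2; blk_compute.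
- rewrite torus_blk; blk_compute.
rewrite X_beta_blk X_alpha_2beta_blk scaleblk addblk ct !scaler0 !addr0 scalemx2.
blk_compute.
Qed.

End Weyl.

(** * The root vectors are nonzero of square zero *)

Lemma X_alpha_sqr0 (F : fieldType) : X_alpha *m X_alpha = 0 :> 'M[F]_4.
Proof. by rewrite X_alpha_blk mulblk !(mul0mx, mulmx0, addr0) -blk_0. Qed.

Lemma X_beta_sqr0 (F : fieldType) : X_beta *m X_beta = 0 :> 'M[F]_4.
Proof.
rewrite X_beta_blk mulblk !(mul0mx, mulmx0, addr0, add0r) !mulmx2 blk_0 mx2_0.
by rewrite !(mul0r, mulr0, addr0).
Qed.

Lemma X_alpha_beta_sqr0 (F : fieldType) : X_alpha_beta *m X_alpha_beta = 0 :> 'M[F]_4.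
Proof. by rewrite X_alpha_beta_blk mulblk !(mul0mx, mulmx0, addr0) -blk_0. Qed.

Lemma X_alpha_neq0 (F : fieldType) : X_alpha != 0 :> 'M[F]_4.
Proof.
apply/eqP; rewrite X_alpha_blk blk_0 mx2_0 => /blk_inj[_ /mx2_inj[_ _ _ /eqP +] _ _].
by rewrite oner_eq0.
Qed.

Lemma X_beta_neq0 (F : fieldType) : X_beta != 0 :> 'M[F]_4.
Proof.
apply/eqP; rewrite X_beta_blk blk_0 mx2_0 => /blk_inj[/mx2_inj[_ /eqP + _ _] _ _ _].
by rewrite oner_eq0.
Qed.

Lemma X_alpha_beta_neq0 (F : fieldType) : X_alpha_beta != 0 :> 'M[F]_4.
Proof.
apply/eqP; rewrite X_alpha_beta_blk blk_0 mx2_0 => /blk_inj[_ /mx2_inj[_ /eqP + _ _] _ _].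
by rewrite oner_eq0.
Qed.

Theorem theorem6p7 (R : realType) :
  [/\ (forall s : {vspace 'M[R[i]]_4},
         sp4_subalgebra s -> \dim s = 2%N -> solvable_lie s ->
         torus 1 1 \in s \/ torus 1 (-1) \in s ->
         ~ cartan_subalgebra s ->
         [\/ sp4_equiv s (span2 (torus 1 1) X_alpha),
             sp4_equiv s (span2 (torus 1 1) X_beta)
           | sp4_equiv s (span2 (torus 1 1) X_alpha_beta)]),
      [/\ ~ sp4_equiv (span2 (torus (1 : R[i]) 1) X_alpha)
                      (span2 (torus 1 1) X_beta),
          ~ sp4_equiv (span2 (torus (1 : R[i]) 1) X_alpha)
                      (span2 (torus 1 1) X_alpha_beta)
        & ~ sp4_equiv (span2 (torus (1 : R[i]) 1) X_beta)
                      (span2 (torus 1 1) X_alpha_beta)],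
      (forall s : {vspace 'M[R[i]]_4},
         s \in [:: span2 (torus 1 1) X_alpha;
                   span2 (torus 1 1) X_beta;
                   span2 (torus 1 1) X_alpha_beta] ->
         [/\ ~ sp4_equiv s cartan_t,
             [/\ ~ sp4_equiv s (span2 (torus 1 0) X_alpha),
                 ~ sp4_equiv s (span2 (torus 1 0) X_beta)
               & ~ sp4_equiv s (span2 (torus 1 0) X_alpha_2beta)],
             ~ sp4_equiv s (span2 (torus 3 1) (X_alpha + X_beta))
           & forall a : R[i], a != 0 -> a != 1 -> a != -1 ->
               [/\ ~ sp4_equiv s (span2 (torus a 1) X_alpha),
                   ~ sp4_equiv s (span2 (torus a 1) X_beta),
                   ~ sp4_equiv s (span2 (torus a 1) X_alpha_beta)
                 & ~ sp4_equiv s (span2 (torus a 1) X_alpha_2beta)]]),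
      sp4_equiv (span2 (torus (1 : R[i]) (-1)) X_alpha_2beta)
                (span2 (torus 1 1) X_alpha)
    & forall c : R[i],
        sp4_equiv (span2 (torus 1 (-1)) (X_beta + c *: X_alpha_2beta))
                  (span2 (torus 1 (-1)) X_beta)].
Proof.
have n2 : (2 : R[i]) != 0 by rewrite pnatr_eq0.
split.
- move=> s sub ds _ [Ts|Ts] nc; first exact: subalgebra_torus1.
  have wU := (in_Sp4P (@weyl_alpha_Sp4 R[i])).1.
  have h : sp4_equiv s (conj_mx weyl_alpha s).
    by exists weyl_alpha => //; apply: in_Sp4P weyl_alpha_Sp4.
  have T1 : torus 1 1 \in conj_mx weyl_alpha s.
    by have := mem_conj weyl_alpha Ts; rewrite weyl_alpha_torus opprK mulmxK.
  have [||k|k|k] := subalgebra_torus1 (subalgebra_equiv h sub) _ T1.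
  + by rewrite (dim_equiv h).
  + by move=> /(cartan_equiv h).
  + by constructor 1; apply: sp4_equiv_trans h k.
  + by constructor 2; apply: sp4_equiv_trans h k.
  + by constructor 3; apply: sp4_equiv_trans h k.
- split; last 1 first.
  (* The equivalence is reversed to put the nonabelian algebra on the left. *)
  + move/sp4_equiv_sym; apply: (@nonabelian_not_equiv_X_beta _ 2) => //.
      exact: X_alpha_beta_neq0.
    exact: lie_torus_X_alpha_beta.
  + apply: (@nonabelian_not_equiv_X_beta _ (2 * 1)); rewrite ?mulr1 //.
      exact: X_alpha_neq0.
    by rewrite lie_torus_X_alpha mulr1.
  + exact: X_alpha_not_equiv_X_alpha_beta.
- move=> s hs.
  have [X [-> XX X0]] : exists X, [/\ s = span2 (torus 1 1) X, X *m X = 0 & X != 0].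
    move: hs; rewrite !inE => /or3P[]/eqP->;
      [exists X_alpha|exists X_beta|exists X_alpha_beta]; split=> //.
    + exact: X_alpha_sqr0.
    + exact: X_alpha_neq0.
    + exact: X_beta_sqr0.
    + exact: X_beta_neq0.
    + exact: X_alpha_beta_sqr0.
    + exact: X_alpha_beta_neq0.
  (* All five second generators have zero lower left block and strictly upper triangular upper left
     block, as [torus1_not_equiv] requires; a zero upper left block is the case x = 0. *)
  have upper a b : a ^+ 2 != b ^+ 2 ->
      [/\ ~ sp4_equiv (span2 (torus 1 1) X) (span2 (torus a b) X_alpha),
          ~ sp4_equiv (span2 (torus 1 1) X) (span2 (torus a b) X_beta),
          ~ sp4_equiv (span2 (torus 1 1) X) (span2 (torus a b) X_alpha_beta),
          ~ sp4_equiv (span2 (torus 1 1) X) (span2 (torus a b) X_alpha_2beta)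
        & ~ sp4_equiv (span2 (torus 1 1) X) (span2 (torus a b) (X_alpha + X_beta))].
    move=> hab; split.
    + by rewrite X_alpha_blk {1}mx2_0; apply: torus1_not_equiv.
    + by rewrite X_beta_blk; apply: torus1_not_equiv.
    + by rewrite X_alpha_beta_blk {1}mx2_0; apply: torus1_not_equiv.
    + by rewrite X_alpha_2beta_blk {1}mx2_0; apply: torus1_not_equiv.
    + by rewrite X_alpha_blk X_beta_blk addblk !add0r !addr0; apply: torus1_not_equiv.
  split.
  + exact: nilpotent_not_equiv_cartan_t.
  + have [] // := upper 1 0.
    by rewrite expr1n expr0n oner_eq0.
  + have [] // := upper 3 1.
    by rewrite expr1n -natrX (eqr_nat _ _ 1).
  + move=> a _ a1 aN1; have [] // := upper a 1.
    by rewrite expr1n sqrf_eq1 negb_or a1 aN1.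
- exact: torus1N1_X_alpha_2beta_equiv.
- by move=> c; apply: torus1N1_X_beta_equiv.
Qed.
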